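(* For every finite simple graph $G$ (with at least one vertex), $$\alpha(G)\geq \sum_{v\in V(G)} \frac{1}{\zeta(v)+1}.$$
   Context: $\alpha(G)$ is the maximum cardinality of an independent set in $G$. For a vertex $v$, $\zeta(v)=\max_H \delta(H)$, the maximum over all subgraphs $H$ of $G$ containing $v$, where $\delta(H)$ is the minimum degree of $H$. *)

(* Defs.v *)
From mathcomp Require Import all_boot all_order all_algebra.

Set Implicit Arguments.
Unset Strict Implicit.
Unset Printing Implicit Defensive.

(* A finite simple graph is a symmetric irreflexive relation on a finType. *)

Section Graph.
Variables (T : finType) (e : rel T).

Definition independent (S : {set T}) : bool :=
  [forall x in S, forall y in S, ~~ e x y].

Definition alpha : nat := \max_(S : {set T} | independent S) #|S|.

(* A candidate subgraph H is a vertex set H.1 with a set of arcs H.2; each edge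
   xy of H is represented by the two arcs (x, y) and (y, x). *)
Definition subgraph (H : {set T} * {set T * T}) : bool :=
  [forall x, forall y, ((x, y) \in H.2) ==>
     [&& x \in H.1, y \in H.1, e x y & (y, x) \in H.2]].

Definition degree (H : {set T} * {set T * T}) (x : T) : nat :=
  #|[set y | (x, y) \in H.2]|.

(* Every degree is at most #|T|, so this is the true minimum as soon as H has
   a vertex. *)
Definition mindeg (H : {set T} * {set T * T}) : nat :=
  \big[minn/#|T|]_(x in H.1) degree H x.

Definition zeta (v : T) : nat :=
  \max_(H : {set T} * {set T * T} | subgraph H && (v \in H.1)) mindeg H.

End Graph.

(* Main.v *)
Require Import Defs.
From mathcomp Require Import all_boot all_order all_algebra.

Set Implicit Arguments.
Unset Strict Implicit.
Unset Printing Implicit Defensive.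

Import Order.TTheory GRing.Theory Num.Theory.
Local Open Scope ring_scope.

(** Greedy choice: if v has minimum degree d in the subgraph induced on S, then
    that subgraph witnesses zeta u >= d for every u in S, so the d + 1 vertices
    of the closed neighbourhood of v in S have total weight at most 1. Put v in
    the independent set, delete this neighbourhood and repeat, always weighting
    vertices by the zeta of the whole graph. *)

Section Greedy.
Variables (T : finType) (e : rel T).
Hypotheses (e_sym : symmetric e) (e_irr : irreflexive e).

Definition induced (S : {set T}) : {set T} * {set T * T} :=
  (S, [set p | [&& p.1 \in S, p.2 \in S & e p.1 p.2]]).

Lemma subgraph_induced (S : {set T}) : subgraph e (induced S).
Proof.
apply/forallP => x; apply/forallP => y; apply/implyP.
by rewrite !inE /= => /and3P[-> -> exy]; rewrite exy e_sym exy.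
Qed.

Lemma degree_induced (S : {set T}) (x : T) :
  x \in S -> degree (induced S) x = #|[set y in S | e x y]|.
Proof. by move=> xS; apply: eq_card => y; rewrite !inE /= xS. Qed.

(** The bound by [#|T|] covers the starting value of the [minn] fold, which enters the minimum along
    with the degrees. *)
Lemma leq_mindeg (H : {set T} * {set T * T}) (d : nat) :
  (d <= #|T|)%N -> (forall x, x \in H.1 -> (d <= degree H x)%N) ->
  (d <= mindeg H)%N.
Proof.
move=> dT dH; rewrite /mindeg.
by elim/big_ind: _ => // m n dm dn; rewrite leq_min dm.
Qed.

Lemma leq_zeta_induced (S : {set T}) (d : nat) :
  (forall x, x \in S -> (d <= #|[set y in S | e x y]|)%N) ->
  forall u, u \in S -> (d <= zeta e u)%N.
Proof.
move=> dS u uS; apply: (@leq_trans (mindeg (induced S))); last first.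
  by apply: leq_bigmax_cond; rewrite subgraph_induced.
(* Since [u] lies in [S], its degree there already keeps [d] at most the default [#|T|]. *)
apply: leq_mindeg => [|x xS]; first exact: leq_trans (dS u uS) (max_card _).
by rewrite degree_induced // dS.
Qed.

Lemma independentU1 (v : T) (I : {set T}) :
  independent e I -> (forall x, x \in I -> ~~ e v x) ->
  independent e (v |: I).
Proof.
move=> /forall_inP indI vI; apply/forall_inP => x xI; apply/forall_inP => y yI.
case/setU1P: xI => [->|xI]; case/setU1P: yI => [->|yI].
- by rewrite e_irr.
- exact: vI.
- by rewrite e_sym vI.
- by move/forall_inP: (indI x xI); apply.
Qed.

(** With [S] arbitrary and [zeta] frozen to that of [e], induction on [#|S|] applies to what is left
    of [S] with unchanged weights. *)
Lemma weighted_independent_subset (S : {set T}) :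
  exists I : {set T}, [/\ I \subset S, independent e I &
    \sum_(u in S) 1 / ((zeta e u)%:R + 1) <= #|I|%:R :> rat].
Proof.
have [n] := ubnP #|S|; elim: n S => // n IHn S ltSn.
have [->|[v0 v0S]] := set_0Vmem S.
  exists set0; split; rewrite ?sub0set ?big_set0 ?cards0 //.
  by apply/forall_inP => x; rewrite inE.
pose nb x := [set y in S | e x y].
case: (arg_minnP (P := [in S]) (fun x => #|nb x|) v0S) => v /= vS vmin.
pose N := v |: nb v.
(* Irreflexivity keeps [v] out of [nb v]; the extra vertex matches the [+ 1] in the denominators. *)
have cardN : #|N| = #|nb v|.+1 by rewrite cardsU1 !inE e_irr andbF.
have sNS : N \subset S.
  by apply/subsetP => x; rewrite !inE => /predU1P[->|/andP[]].
have cardS' : (#|S :\: N| < n)%N.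
  rewrite -ltnS; apply: leq_trans ltSn; rewrite ltnS.
  by apply/proper_card/properP; split; [exact: subsetDl|exists v; rewrite ?inE ?eqxx].
have [I [sIS' indI leI]] := IHn _ cardS'.
have vI : v \notin I by apply: contraTN isT => /(subsetP sIS'); rewrite !inE eqxx.
exists (v |: I); split.
- by rewrite subUset sub1set vS (subset_trans sIS') ?subsetDl.
- apply: independentU1 => // x /(subsetP sIS').
  by rewrite !inE negb_or => /andP[/andP[_ +] xS]; rewrite xS.
(* The weights on [S :\: N] are paid for by [I], those on [N] by the one new vertex [v]. *)
rewrite (big_setID N) /= (setIidPr sNS) cardsU1 vI natrD lerD //.
apply: (@le_trans _ _ (\sum_(u in N) #|N|%:R^-1)); last first.
  by rewrite sumr_const -[X in X <= _]mulr_natl divff // pnatr_eq0 cardN.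
(* By [vmin], all degrees within [S] are at least [#|nb v|], so [zeta e u + 1] is at least
   [#|N|]. *)
apply: ler_sum => u /(subsetP sNS) uS.
rewrite natr1 div1r lef_pV2 ?posrE ?ltr0n ?cardN // ler_nat ltnS.
exact: leq_zeta_induced uS.
Qed.

End Greedy.

Theorem theorem1 (T : finType) (e : rel T)
    (e_sym : symmetric e) (e_irr : irreflexive e) (T_gt0 : (0 < #|T|)%N) :
  \sum_(v : T) 1 / ((zeta e v)%:R + 1) <= (alpha e)%:R :> rat.
Proof.
have [I [_ indI leI]] := weighted_independent_subset e_sym e_irr [set: T].
rewrite (eq_bigl _ _ (@in_setT T)) in leI; apply: le_trans leI _; rewrite ler_nat.
exact: leq_bigmax_cond.
Qed.
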